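(* The intrinsic group of $KD(n)$ is $\mathbb{Z}_2\times\mathbb{Z}_2$ if $n$ is odd and $D_4$ (the dihedral group of order $8$) if $n$ is even.
   Context: The intrinsic group of a finite-dimensional Kac algebra ($C^*$-Hopf algebra) $K$ is the group of invertible $x\in K$ with $\Delta(x)=x\otimes x$. $KD(n)$ ($n\ge1$): let $D_{2n}=\langle a,b\mid a^{2n}=b^2=1,\ ba=a^{-1}b\rangle$ (order $4n$), with canonical basis $\lambda(g)$ of $\mathbb{C}[D_{2n}]$, and $\Delta_s(\lambda(g))=\lambda(g)\otimes\lambda(g)$. Put $h_1=1,h_2=a^n,h_3=b,h_4=ba^n$, $\nu=-1+2\mathrm{i}$, and $\Omega=\sum_{i,j}c_{i,j}\lambda(h_i)\otimes\lambda(h_j)$ with $$(c_{i,j})=\frac18\begin{pmatrix}5&1&1&1\\1&1&\bar\nu&\nu\\1&\nu&1&\bar\nu\\1&\bar\nu&\nu&1\end{pmatrix}.$$ $\Omega$ is unitary. $KD(n)$ is the $*$-algebra $\mathbb{C}[D_{2n}]$ with its usual counit and antipode and the coproduct $\Delta(x)=\Omega\Delta_s(x)\Omega^*$. *)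

(* Defs.v *)
(* MathComp; the complex numbers are R[i] over an R : realType. *)
From HB Require Import structures.
From mathcomp Require Import all_boot all_order all_algebra all_fingroup.
From mathcomp Require Import all_solvable.
From mathcomp Require Import reals complex.

Set Implicit Arguments.
Unset Strict Implicit.
Unset Printing Implicit Defensive.

Import Order.TTheory GRing.Theory Num.Theory.
Local Open Scope ring_scope.

(* The group algebra C[gT]: x g is the coefficient of x at the basis vector
   lambda(g).  {ffun gT -> C} carries a pointwise product in MathComp, hence the
   alias, on which * is the convolution product. *)
Definition galg (C : comNzRingType) (gT : finGroupType) : Type :=
  {ffun gT -> C}.

Section GroupAlgebra.

Variables (C : comNzRingType) (gT : finGroupType).
Local Notation A := (galg C gT).

HB.instance Definition _ := GRing.Lmodule.copy A {ffun gT -> C^o}.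

Definition lambda (g : gT) : A := [ffun h => (h == g)%:R].

Definition galg_mul (x y : A) : A :=
  [ffun g => \sum_(h : gT) x h * y (h^-1 * g)%g].

Lemma galg_sumE I (r : seq I) (P : pred I) (F : I -> A) g :
  (\sum_(i <- r | P i) F i : A) g = \sum_(i <- r | P i) F i g.
Proof. by rewrite (@sum_ffunE gT C). Qed.

Lemma galg_expand (x : A) : x = \sum_g x g *: lambda g.
Proof.
apply/ffunP=> g; rewrite galg_sumE (bigD1 g) //= big1 => [|h hg]; last first.
  by rewrite !ffunE eq_sym (negbTE hg) /GRing.scale /= mulr0.
by rewrite !ffunE eqxx addr0 /GRing.scale /= mulr1.
Qed.

Fact galg_mulA : associative galg_mul.
Proof.
move=> x y z; apply/ffunP=> g; rewrite !ffunE.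
under eq_bigr do rewrite ffunE mulr_sumr.
under [RHS]eq_bigr do rewrite ffunE mulr_suml.
rewrite [RHS]exchange_big /=; apply: eq_bigr => h _.
rewrite [RHS](reindex_inj (mulgI h)) /=; apply: eq_bigr => k _.
by rewrite mulrA mulKg invMg mulgA.
Qed.

Fact galg_mul1x : left_id (lambda 1) galg_mul.
Proof.
move=> x; apply/ffunP=> g; rewrite ffunE (bigD1 1%g) //= big1 => [|h h1].
  by rewrite ffunE eqxx mul1r invg1 mul1g addr0.
by rewrite ffunE (negbTE h1) mul0r.
Qed.

Fact galg_mulx1 : right_id (lambda 1) galg_mul.
Proof.
move=> x; apply/ffunP=> g; rewrite ffunE (bigD1 g) //= big1 => [|h hg].
  by rewrite ffunE mulVg eqxx mulr1 addr0.
by rewrite ffunE -eq_mulVg1 (negbTE hg) mulr0.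
Qed.

Fact galg_mulDl : left_distributive galg_mul +%R.
Proof.
move=> x y z; apply/ffunP=> g; rewrite !ffunE -big_split /=.
by apply: eq_bigr => h _; rewrite ffunE mulrDl.
Qed.

Fact galg_mulDr : right_distributive galg_mul +%R.
Proof.
move=> x y z; apply/ffunP=> g; rewrite !ffunE -big_split /=.
by apply: eq_bigr => h _; rewrite ffunE mulrDr.
Qed.

Fact galg_1_neq0 : lambda 1 != 0.
Proof.
apply/eqP=> /ffunP/(_ 1%g)/eqP.
by rewrite !ffunE eqxx oner_eq0.
Qed.

HB.instance Definition _ := GRing.Zmodule_isNzRing.Build A
  galg_mulA galg_mul1x galg_mulx1 galg_mulDl galg_mulDr galg_1_neq0.

Fact galg_scaleAl (c : C) (x y : A) : c *: (x * y) = c *: x * y.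
Proof.
apply/ffunP=> g; rewrite !ffunE /GRing.scale /= mulr_sumr.
by apply: eq_bigr => h _; rewrite !ffunE /GRing.scale /= mulrA.
Qed.

Fact galg_scaleAr (c : C) (x y : A) : c *: (x * y) = x * (c *: y).
Proof.
apply/ffunP=> g; rewrite !ffunE /GRing.scale /= mulr_sumr.
by apply: eq_bigr => h _; rewrite !ffunE /GRing.scale /= mulrCA.
Qed.

HB.instance Definition _ := GRing.Lmodule_isLalgebra.Build C A galg_scaleAl.
HB.instance Definition _ := GRing.Lalgebra_isAlgebra.Build C A galg_scaleAr.

Lemma lambda1 : lambda 1 = 1. Proof. by []. Qed.

Lemma lambdaM g h : lambda (g * h) = lambda g * lambda h.
Proof.
apply/ffunP=> k; rewrite [RHS]ffunE (bigD1 g) //= big1 => [|j jg].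
  by rewrite !ffunE eqxx mul1r addr0 -(inj_eq (mulgI g) (g^-1 * k)%g h) mulKVg.
by rewrite ffunE (negbTE jg) mul0r.
Qed.

End GroupAlgebra.

Section KacMaps.

Variables (C : comNzRingType) (gT : finGroupType).
Local Notation A := (galg C gT).

(* C[gT] (x) C[gT] is identified with C[gT * gT]; in this identification
   lambda(g) (x) lambda(h) is lambda((g, h)). *)
Definition tens (x y : A) : galg C (gT * gT)%type :=
  [ffun p => x p.1 * y p.2].

(* The linear map with lambda(g) |-> lambda(g) (x) lambda(g). *)
Definition Delta_s (x : A) : galg C (gT * gT)%type :=
  \sum_g x g *: tens (lambda C g) (lambda C g).

Definition galg_counit (x : A) : C := \sum_g x g.

Definition galg_antipode (x : A) : A := [ffun g => x g^-1%g].

(* The structure maps of a Kac algebra whose underlying *-algebra is C[gT]. *)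
Record kac_maps := KacMaps {
  comul : A -> galg C (gT * gT)%type;
  counit : A -> C;
  antipode : A -> A
}.

Definition in_intrinsic_group (K : kac_maps) (x : A) : Prop :=
  (exists y : A, x * y = 1 /\ y * x = 1) /\ comul K x = tens x x.

(* f is an isomorphism of H onto the intrinsic group of K, whose law is the
   product of C[gT]. *)
Definition intrinsic_group_isog (K : kac_maps) (H : finGroupType) : Prop :=
  exists f : H -> A,
    [/\ injective f,
        forall u v : H, f (u * v)%g = f u * f v
      & forall x : A, in_intrinsic_group K x <-> exists u : H, x = f u].

End KacMaps.

(* lambda(g)^* = lambda(g^-1), extended antilinearly. *)
Definition galg_star (C : numClosedFieldType) (gT : finGroupType)
    (x : galg C gT) : galg C gT :=
  [ffun g => (x g^-1%g)^*].

(* a and b exhibit gT as <a, b | a^m = b^2 = 1, ba = a^-1 b>, of order 2m: since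
   the presented group has order 2m, the cardinality condition excludes its
   proper quotients. *)
Definition dihedral_presentation (gT : finGroupType) (m : nat) (a b : gT) :
    Prop :=
  [/\ <<[set a; b]>>%g = [set: gT],
      (a ^+ m = 1)%g, (b ^+ 2 = 1)%g, (b * a = a^-1 * b)%g
    & #|gT| = m.*2].

Lemma dihedral_presentation_ex (m : nat) : (1 < m)%N ->
  exists a b : 'D_m.*2, dihedral_presentation m a b.
Proof.
move=> m_gt1; have cD : #|[set: 'D_m.*2]| = m.*2 := card_dihedral m_gt1.
have := Grp_dihedral m_gt1 [set: 'D_m.*2]%G; rewrite homg_refl => /esym/existsP.
case=> -[a b] /=; rewrite !xpair_eqE /= => /and4P[/eqP gD /eqP am /eqP b2].
move=> /eqP ab; exists a, b; split=> //; last by rewrite -cardsT.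
- by rewrite -[RHS]gD joing_idl joing_idr.
- by rewrite -ab conjgE -!mulgA -expg2 b2 mulg1 -{1}(mulKg b b) -expg2 b2 mulg1.
Qed.

Section KD.

Variables (C : numClosedFieldType) (gT : finGroupType) (n : nat) (a b : gT).

Definition KD_h (i : 'I_4) : gT :=
  nth 1%g [:: 1; a ^+ n; b; b * a ^+ n]%g i.

Definition KD_nu : C := -1 + 'i *+ 2.

Definition KD_c (i j : 'I_4) : C :=
  let nu := KD_nu in
  nth 0 (nth [::]
    [:: [:: 5; 1;    1;    1   ];
        [:: 1; 1;    nu^*; nu  ];
        [:: 1; nu;   1;    nu^*];
        [:: 1; nu^*; nu;   1   ]] i) j / 8.

Definition KD_Omega : galg C (gT * gT)%type :=
  \sum_i \sum_j KD_c i j *: tens (lambda C (KD_h i)) (lambda C (KD_h j)).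

Definition KD : kac_maps C gT :=
  {| comul := fun x => KD_Omega * Delta_s x * galg_star KD_Omega;
     counit := @galg_counit C gT;
     antipode := @galg_antipode C gT |}.

End KD.

(* Main.v *)
Require Import Defs.
From HB Require Import structures.
From mathcomp Require Import all_boot all_order all_algebra all_fingroup.
From mathcomp Require Import all_solvable.
From mathcomp Require Import reals complex.
From mathcomp Require Import ring.

Set Implicit Arguments.
Unset Strict Implicit.
Unset Printing Implicit Defensive.

Import Order.TTheory GRing.Theory Num.Theory.
Local Open Scope ring_scope.

(** Write z = a^n, a central involution, and V = {1, z, b, bz}, a Klein
four-group.  The Fourier transform identifies C[V] with the functions on the
dual of V, whose points f = (s, t) stand for the characters z |-> (-1)^s,
b |-> (-1)^t.  Under it Omega becomes the two-variable function [pauli], the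
cocycle of the Pauli matrices ([Omega_spec2]): it is unitary, its transpose is
its inverse, its square is the sign (-1)^(symplectic form) ([pauli_square]),
and this sign is the coboundary of the function [usign], which is 1 at the
trivial character and -1 elsewhere ([usign_coboundary]).  Let U be the element
of C[V] with Fourier transform [usign]; U^2 = 1.

Let x lie in the intrinsic group.  Exchanging the two tensor factors in
Omega Delta_s(x) Omega^* = x (x) x turns Omega into Omega^*, and comparing the
two equations shows that x (x) x commutes with S = Omega^2.  Cutting this
relation by the central idempotents (1 +- z)/2 on either side gives
x b = z^k b x with k = 0 or 1 ([intrinsic_conj]).

Conversely, if x b = z^k b x then conjugation by x (x) x fixes Omega when k = 0
and transposes it, that is inverts it, when k = 1.  Hence
Delta(x) = x (x) x is equivalent to Delta_s(x) = S^k (x (x) x), and, as S is the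
coboundary of U, to Delta_s(U^k x) = U^k x (x) U^k x ([comul_untwist]).  The
group-like elements of a group algebra are the group elements, so the intrinsic
group consists of the U^k lambda(g) with g b = z^k b g ([intrinsic_KD]).

Thus the intrinsic group is isomorphic to the group of the g such that
g b g^-1 is b or zb ([intrinsic_isog]).  For g = a^i b^j the condition says that
a^(2i) is 1 or a^n, that is, that n divides 2i.  So this group is generated by
a^n and b when n is odd, and by a^(n/2) and b when n is even: a dihedral group
of order 4 or 8. *)

(** * Tensor products and the cocommutative coproduct of a group algebra *)

Section TensorSquare.

Variables (C : comNzRingType) (gT : finGroupType).
Local Notation A := (galg C gT).
Local Notation A2 := (galg C (gT * gT)%type).
Implicit Types (x y : A) (X Y : A2) (c : C).

Lemma galg0E (hT : finGroupType) g : (0 : galg C hT) g = 0.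
Proof. by rewrite ffunE. Qed.

Lemma galgDE (hT : finGroupType) (x y : galg C hT) g : (x + y) g = x g + y g.
Proof. by rewrite ffunE. Qed.

Lemma galgZE (hT : finGroupType) c (x : galg C hT) g : (c *: x) g = c * x g.
Proof. by rewrite ffunE. Qed.

Lemma lambda_inj : injective (@lambda C gT).
Proof.
move=> g h /ffunP/(_ g); rewrite !ffunE eqxx; case: eqP => // _ /eqP.
by rewrite oner_eq0.
Qed.

Lemma lambda_mulE g x h : (lambda C g * x) h = x (g^-1 * h)%g.
Proof.
rewrite ffunE (bigD1 g) //= big1 => [|k kg]; rewrite ffunE.
  by rewrite eqxx mul1r addr0.
by rewrite (negbTE kg) mul0r.
Qed.

Lemma mul_lambdaE g x h : (x * lambda C g) h = x (h * g^-1)%g.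
Proof.
rewrite ffunE (bigD1 (h * g^-1)%g) //= big1 => [|k kg]; rewrite ffunE.
  by rewrite invMg invgK mulgKV eqxx mulr1 addr0.
rewrite -(inj_eq (mulgI k)) mulKVg -(inj_eq (mulIg g^-1%g)) mulgK eq_sym.
by rewrite (negbTE kg) mulr0.
Qed.

Lemma lambda_central g x :
  (forall h, commute g h) -> x * lambda C g = lambda C g * x.
Proof.
move=> cg; apply/ffunP=> h; rewrite lambda_mulE mul_lambdaE; congr (x _).
exact: commuteV (commute_sym (cg h)).
Qed.

Lemma tensZl c x y : tens (c *: x) y = c *: tens x y.
Proof.
by apply/ffunP=> p; rewrite galgZE [LHS]ffunE [in RHS]ffunE galgZE mulrA.
Qed.

Lemma tensZr c x y : tens x (c *: y) = c *: tens x y.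
Proof.
by apply/ffunP=> p; rewrite galgZE [LHS]ffunE [in RHS]ffunE galgZE mulrCA.
Qed.

Lemma tens_sum (I J : finType) (F : I -> A) (G : J -> A) :
  tens (\sum_i F i) (\sum_j G j) = \sum_i \sum_j tens (F i) (G j).
Proof.
apply/ffunP=> p; rewrite ffunE !galg_sumE big_distrlr /=.
apply: eq_bigr => i _; rewrite galg_sumE; apply: eq_bigr => j _.
by rewrite ffunE.
Qed.

Lemma tens_lambda (g h : gT) :
  tens (lambda C g) (lambda C h) = lambda C (g, h).
Proof.
by apply/ffunP=> -[p q]; rewrite !ffunE /= xpair_eqE -natrM mulnb.
Qed.

Lemma tens11 : tens 1 1 = 1 :> A2.
Proof. exact: tens_lambda. Qed.

Lemma tensM x x' y y' : tens x y * tens x' y' = tens (x * x') (y * y').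
Proof.
apply/ffunP=> p; rewrite !ffunE big_distrlr pair_big /=.
by apply: eq_bigr => h _; rewrite !ffunE /= mulrACA.
Qed.

Lemma Delta_sE x p : Delta_s x p = (p.1 == p.2)%:R * x p.1.
Proof.
rewrite galg_sumE (bigD1 p.1) //= big1 => [|g gp]; rewrite galgZE !ffunE.
  by rewrite eqxx mul1r addr0 eq_sym mulrC.
by rewrite eq_sym (negbTE gp) mul0r mulr0.
Qed.

Lemma Delta_sD x y : Delta_s (x + y) = Delta_s x + Delta_s y.
Proof. by apply/ffunP=> p; rewrite galgDE !Delta_sE galgDE mulrDr. Qed.

Lemma Delta_sZ c x : Delta_s (c *: x) = c *: Delta_s x.
Proof. by apply/ffunP=> p; rewrite galgZE !Delta_sE galgZE mulrCA. Qed.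

Lemma Delta_s_sum (I : finType) (F : I -> A) :
  Delta_s (\sum_i F i) = \sum_i Delta_s (F i).
Proof.
apply/ffunP=> p; rewrite Delta_sE !galg_sumE mulr_sumr.
by apply: eq_bigr => i _; rewrite Delta_sE.
Qed.

Lemma Delta_s_lambda (g : gT) :
  Delta_s (lambda C g) = tens (lambda C g) (lambda C g).
Proof.
apply/ffunP=> -[p q]; rewrite Delta_sE !ffunE /= -!natrM !mulnb.
by rewrite andbC; case: (eqVneq p g) => [->|] //=; rewrite eq_sym.
Qed.

Lemma Delta_s1 : Delta_s 1 = 1 :> A2.
Proof. by rewrite -lambda1 Delta_s_lambda tens_lambda. Qed.

Lemma Delta_sM x y : Delta_s (x * y) = Delta_s x * Delta_s y.
Proof.
rewrite (galg_expand x) (galg_expand y) big_distrlr !Delta_s_sum big_distrlr /=.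
apply: eq_bigr => g _; rewrite Delta_s_sum; apply: eq_bigr => h _.
rewrite -scalerAl -scalerAr -lambdaM !Delta_sZ !Delta_s_lambda.
by rewrite -scalerAl -scalerAr tensM -lambdaM.
Qed.

Definition flip X : A2 := [ffun p => X (p.2, p.1)].

Lemma flipM X Y : flip (X * Y) = flip X * flip Y.
Proof.
apply/ffunP=> p; rewrite !ffunE.
rewrite (reindex_inj (h := fun q : gT * gT => (q.2, q.1))) /=.
  by apply: eq_bigr => h _; rewrite !ffunE.
by move=> [? ?] [? ?] /= [-> ->].
Qed.

Lemma flip_tens x y : flip (tens x y) = tens y x.
Proof. by apply/ffunP=> p; rewrite !ffunE mulrC. Qed.

Lemma flip_Delta_s x : flip (Delta_s x) = Delta_s x.
Proof.
apply/ffunP=> p; rewrite ffunE !Delta_sE /= eq_sym.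
by case: eqP => [->|_] //; rewrite !mul0r.
Qed.

Lemma flip_sum (I : finType) (F : I -> A2) :
  flip (\sum_i F i) = \sum_i flip (F i).
Proof.
apply/ffunP=> p; rewrite ffunE !galg_sumE.
by apply: eq_bigr => i _; rewrite ffunE.
Qed.

Lemma flipZ c X : flip (c *: X) = c *: flip X.
Proof. by apply/ffunP=> p; rewrite !ffunE. Qed.

End TensorSquare.

Section TensorSquareField.

Variables (C : fieldType) (gT : finGroupType).
Local Notation A := (galg C gT).
Implicit Types (x y : A).

Lemma galg_neq0 x : x != 0 -> exists g, x g != 0.
Proof.
move=> x0; apply/existsP; apply: contraNT x0 => /existsPn x0.
by apply/eqP/ffunP=> g; rewrite ffunE; apply/eqP; rewrite -[_ == _]negbK x0.
Qed.

Lemma tens_cancel x x' y : y != 0 -> tens x y = tens x' y -> x = x'.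
Proof.
case/galg_neq0 => q yq /ffunP e; apply/ffunP=> p.
by have := e (p, q); rewrite !ffunE /= => /(mulIf yq).
Qed.

Lemma tens_square x y : tens x x = tens y y -> x = y \/ x = - y.
Proof.
move/ffunP=> e; have {}e p q : x p * x q = y p * y q.
  by have := e (p, q); rewrite !ffunE.
have [x0|/galg_neq0 [p xp]] := eqVneq x 0.
  left; rewrite x0; apply/esym/ffunP=> p; apply/eqP; have := e p p.
  by rewrite x0 !galg0E mul0r => /esym/eqP; rewrite mulf_eq0 orbb.
have /eqP := e p p; rewrite -!expr2 eqf_sqr => /orP[]/eqP ep; [left|right].
- by apply/ffunP=> q; apply: (mulfI xp); rewrite e -ep.
- by apply/ffunP=> q; apply: (mulfI xp); rewrite e ep ffunE mulrNN.
Qed.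

(** In coordinates the hypothesis reads x_p x_q = 0 for p != q and
x_p^2 = x_p: at most one coordinate is nonzero, and it is then 1. *)
Lemma grouplike x : x != 0 -> Delta_s x = tens x x -> exists g, x = lambda C g.
Proof.
case/galg_neq0=> g xg /ffunP e.
have {}e p q : x p * x q = (p == q)%:R * x p.
  by have := e (p, q); rewrite Delta_sE !ffunE.
exists g; apply/ffunP=> h; apply: (mulfI xg).
by rewrite e ffunE mulrC eq_sym.
Qed.

End TensorSquareField.

(** * The Pauli cocycle on the dual of the Klein four-group *)

(** The pair (s, t) is the character of {1, z, b, bz} with z |-> (-1)^s and
b |-> (-1)^t. *)
Notation dual4 := (bool * bool)%type.

Definition dual_mul (f g : dual4) : dual4 := (f.1 (+) g.1, f.2 (+) g.2).

Definition sympl (f g : dual4) : bool := (f.1 && g.2) (+) (f.2 && g.1).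

(** The action on characters of an automorphism that fixes z and maps b
to z^k b. *)
Definition shear (k : bool) (f : dual4) : dual4 := (f.1, f.2 (+) (k && f.1)).

Lemma shearK k : involutive (shear k).
Proof. by case: k => -[[] []]. Qed.

Section PauliCocycle.

Variable C : numClosedFieldType.

Let mulii : 'i * 'i = -1 :> C. Proof. by rewrite -expr2 sqrCi. Qed.
Let i_neq0 : 'i != 0 :> C. Proof. exact: neq0Ci. Qed.

Definition pauli_phase (f : dual4) : C := if f.1 && f.2 then - 'i else 1.

(** The matrices P_f = pauli_phase(f) X^s Z^t, for f = (s, t) and X, Z two
anticommuting involutions, multiply by P_f P_g = pauli(f, g) P_(fg): a
bicharacter times a coboundary.  The values are 1 and, on pairs of distinct
nontrivial characters, i or -i. *)
Definition pauli (f g : dual4) : C :=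
  (-1) ^+ (f.2 && g.1) *
  (pauli_phase f * pauli_phase g / pauli_phase (dual_mul f g)).

Definition usign (f : dual4) : C := if f == (false, false) then 1 else -1.

(** The values are roots of unity, and [pauli] is hermitian because each
P_f is: the transpose is therefore the inverse. *)
Lemma pauli_sym f g : pauli f g * pauli g f = 1.
Proof.
by case: f g => [[] []] [[] []]; rewrite /pauli /pauli_phase /dual_mul /=
  ?expr0 ?expr1; field: mulii; rewrite ?i_neq0 ?oppr_eq0.
Qed.

(** As the transpose of [pauli] is its inverse, the square is the
commutation factor P_f P_g P_f^-1 P_g^-1 of two Pauli matrices. *)
Lemma pauli_square f g : pauli f g * pauli f g = (-1) ^+ sympl f g.
Proof.
by case: f g => [[] []] [[] []]; rewrite /pauli /pauli_phase /sympl /dual_mul /=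
  ?expr0 ?expr1; field: mulii; rewrite ?i_neq0.
Qed.

(** The shear is an odd permutation of the three nontrivial characters,
and the sign of the values i, -i of [pauli] is their cyclic orientation. *)
Lemma pauli_shear f g : pauli (shear true f) (shear true g) = pauli g f.
Proof.
by case: f g => [[] []] [[] []]; rewrite /pauli /pauli_phase /dual_mul /=
  ?expr0 ?expr1; field: mulii; rewrite ?i_neq0.
Qed.

(** The class of the Pauli cocycle has order two.  For distinct nontrivial f, g
the product fg is the third nontrivial character, and (-1)(-1)/(-1) = -1. *)
Lemma usign_coboundary f g :
  usign (dual_mul f g) * (-1) ^+ sympl f g = usign f * usign g.
Proof.
by case: f g => [[] []] [[] []]; rewrite /usign /sympl /dual_mul !xpair_eqE /=
  ?expr0 ?expr1; ring.
Qed.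

End PauliCocycle.

(** * Spectral projections of an involution *)

Section Involution.

Variables (C : numClosedFieldType) (gT : finGroupType).
Local Notation A := (galg C gT).

Definition eigenproj (g : gT) (s : bool) : A :=
  2^-1 *: (1 + (-1) ^+ s *: lambda C g).

Lemma half_sign (s t : bool) :
  2^-1 * (1 + (-1) ^+ s * (-1) ^+ t) = (s == t)%:R :> C.
Proof. by case: s t => [] [] /=; rewrite ?expr0 ?expr1; field. Qed.

Variable g : gT.
Hypothesis gg : (g * g = 1)%g.

Lemma lambda_eigenproj s :
  lambda C g * eigenproj g s = (-1) ^+ s *: eigenproj g s.
Proof.
rewrite /eigenproj -scalerAr mulrDr -scalerAr -(lambdaM _ g g) gg mulr1 lambda1.
rewrite [RHS]scalerA mulrC -scalerA; congr (_ *: _).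
by rewrite scalerDr scalerA -signr_addb addbb scale1r addrC.
Qed.

Lemma eigenproj_sum : eigenproj g true + eigenproj g false = 1.
Proof.
rewrite -scalerDr expr0 expr1 addrACA -scalerDl addNr scale0r addr0.
by rewrite -mulr2n -scaler_nat scalerA mulVf ?scale1r ?pnatr_eq0.
Qed.

Lemma eigenproj_eigen s (t : bool) (x : A) : lambda C g * x = (-1) ^+ t *: x ->
  eigenproj g s * x = (s == t)%:R *: x.
Proof.
move=> gx; rewrite -scalerAl mulrDl mul1r -scalerAl gx scalerA.
by rewrite -[X in X + _]scale1r -scalerDl scalerA half_sign.
Qed.

(** [g] acts through [Delta_s] by g (x) g, so eigenvalues multiply. *)
Lemma Delta_s_eigenproj s (t1 t2 : bool) (x y : A) :
  lambda C g * x = (-1) ^+ t1 *: x -> lambda C g * y = (-1) ^+ t2 *: y ->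
  Delta_s (eigenproj g s) * tens x y = (s == t1 (+) t2)%:R *: tens x y.
Proof.
move=> gx gy; rewrite Delta_sZ Delta_sD Delta_s1 Delta_sZ Delta_s_lambda.
rewrite -scalerAl mulrDl mul1r -scalerAl tensM gx gy tensZl tensZr !scalerA.
rewrite -[X in X + _]scale1r -scalerDl scalerA -signr_addb.
by rewrite half_sign.
Qed.

Lemma eigenproj_swap s (x : A) : lambda C g * x = x * lambda C g ->
  x * eigenproj g s = eigenproj g s * x.
Proof.
move=> gx; rewrite /eigenproj -scalerAr -scalerAl mulrDr mulrDl mulr1 mul1r.
by rewrite -scalerAr -scalerAl gx.
Qed.

End Involution.

(** * Fourier transform on a Klein four-subgroup *)

Section Fourier.

Variables (C : numClosedFieldType) (gT : finGroupType) (z b : gT).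
Local Notation A := (galg C gT).
Local Notation A2 := (galg C (gT * gT)%type).
Hypotheses (zz : (z * z = 1)%g) (bb : (b * b = 1)%g) (zb : commute z b).

(** The minimal idempotent of the algebra spanned by 1, z, b, bz that belongs
to the character [f]. *)
Definition idem (f : dual4) : A := eigenproj C z f.1 * eigenproj C b f.2.

(** The element whose Fourier transform is [u]. *)
Definition spec (u : dual4 -> C) : A := \sum_f u f *: idem f.

Definition spec2 (F : dual4 -> dual4 -> C) : A2 :=
  \sum_f \sum_g F f g *: tens (idem f) (idem g).

Lemma lambda_z_idem f : lambda C z * idem f = (-1) ^+ f.1 *: idem f.
Proof. by rewrite mulrA lambda_eigenproj // -scalerAl. Qed.

Lemma lambda_b_idem f : lambda C b * idem f = (-1) ^+ f.2 *: idem f.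
Proof.
rewrite mulrA (@eigenproj_swap _ _ z); last by rewrite -!lambdaM zb.
by rewrite -mulrA lambda_eigenproj // -scalerAr.
Qed.

Lemma idemM f g : idem f * idem g = (f == g)%:R *: idem g.
Proof.
rewrite {1}/idem -mulrA (eigenproj_eigen _ (lambda_b_idem g)) -scalerAr.
rewrite (eigenproj_eigen _ (lambda_z_idem g)) scalerA -natrM mulnb andbC.
by rewrite -xpair_eqE; case: f g => ? ? [].
Qed.

Lemma sum_dual4 (V : nmodType) (F : dual4 -> V) :
  \sum_f F f = \sum_s \sum_t F (s, t).
Proof. by rewrite pair_bigA; apply: eq_bigr => -[]. Qed.

Lemma idem_sum : \sum_f idem f = 1.
Proof.
have idemE s t : idem (s, t) = eigenproj C z s * eigenproj C b t by [].
rewrite sum_dual4 -(eigenproj_sum C z) -[RHS]big_bool.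
apply: eq_bigr => s _; rewrite big_bool !idemE /= -mulrDr (eigenproj_sum C b).
exact: mulr1.
Qed.

Lemma sum_delta (V : lmodType C) (F : dual4 -> V) f :
  \sum_g (f == g)%:R *: F g = F f.
Proof.
rewrite (bigD1 f) //= eqxx scale1r big1 ?addr0 // => g.
by rewrite eq_sym => /negbTE->; rewrite scale0r.
Qed.

Lemma spec_idem u f : spec u * idem f = u f *: idem f.
Proof.
rewrite mulr_suml -(sum_delta (fun g => u g *: idem f) f).
apply: eq_bigr => g _; rewrite -scalerAl idemM scalerA mulrC -scalerA eq_sym.
by case: eqP => [->|]; rewrite ?scale0r.
Qed.

(** The idempotents sum to 1: an element is known from how it acts on them. *)
Lemma spec_eigen (x : A) u :
  (forall f, x * idem f = u f *: idem f) -> x = spec u.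
Proof.
move=> xu; rewrite -[LHS]mulr1 -idem_sum mulr_sumr.
by apply: eq_bigr => f _; rewrite xu.
Qed.

Lemma specM u v : spec u * spec v = spec (fun f => u f * v f).
Proof.
rewrite [in LHS]/spec -/(spec u) mulr_sumr; apply: eq_bigr => f _.
by rewrite -scalerAr spec_idem scalerA mulrC.
Qed.

Lemma tens_spec u v : tens (spec u) (spec v) = spec2 (fun f g => u f * v g).
Proof.
rewrite tens_sum; apply: eq_bigr => f _; apply: eq_bigr => g _.
by rewrite tensZl tensZr scalerA.
Qed.

Lemma tens_idemM h k f g :
  tens (idem h) (idem k) * tens (idem f) (idem g) =
  ((f == h)%:R * (g == k)%:R) *: tens (idem f) (idem g).
Proof.
rewrite tensM (idemM h f) (idemM k g) tensZl tensZr scalerA.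
by rewrite (eq_sym f) (eq_sym g).
Qed.

Lemma spec2_idem F f g :
  spec2 F * tens (idem f) (idem g) = F f g *: tens (idem f) (idem g).
Proof.
have eT h k := tens_idemM h k f g.
set T := tens (idem f) (idem g) in eT *; clearbody T.
rewrite mulr_suml -(sum_delta (fun h => F h g *: T) f).
apply: eq_bigr => h _; rewrite mulr_suml -(sum_delta (fun k => F h k *: T) g).
rewrite scaler_sumr; apply: eq_bigr => k _.
by rewrite -scalerAl eT !scalerA; congr (_ *: _); ring.
Qed.

Lemma spec2_eigen (X : A2) F :
  (forall f g, X * tens (idem f) (idem g) = F f g *: tens (idem f) (idem g)) ->
  X = spec2 F.
Proof.
move=> XF; rewrite -[LHS]mulr1 -tens11 -idem_sum tens_sum mulr_sumr.
apply: eq_bigr => f _; rewrite mulr_sumr; apply: eq_bigr => g _.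
exact: XF.
Qed.

Lemma spec2M F G : spec2 F * spec2 G = spec2 (fun f g => F f g * G f g).
Proof.
apply: spec2_eigen => f g.
by rewrite -mulrA spec2_idem -scalerAr spec2_idem scalerA mulrC.
Qed.

Lemma spec2_1 : spec2 (fun _ _ => 1) = 1.
Proof. by apply/esym/spec2_eigen => f g; rewrite mul1r scale1r. Qed.

Lemma eq_spec2 F G : (forall f g, F f g = G f g) -> spec2 F = spec2 G.
Proof.
by move=> FG; apply: eq_bigr => f _; apply: eq_bigr => g _; rewrite FG.
Qed.

Lemma flip_spec2 F : flip (spec2 F) = spec2 (fun f g => F g f).
Proof.
rewrite flip_sum [RHS]exchange_big; apply: eq_bigr => f _.
by rewrite flip_sum; apply: eq_bigr => g _; rewrite flipZ flip_tens.
Qed.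

Lemma Delta_s_spec u : Delta_s (spec u) = spec2 (fun f g => u (dual_mul f g)).
Proof.
apply: spec2_eigen => f g; rewrite Delta_s_sum mulr_suml.
rewrite -(sum_delta (fun h => u h *: tens (idem f) (idem g))).
apply: eq_bigr => h _; rewrite Delta_sZ -scalerAl Delta_sM -mulrA.
rewrite (Delta_s_eigenproj _ (lambda_b_idem f) (lambda_b_idem g)) -scalerAr.
rewrite (Delta_s_eigenproj _ (lambda_z_idem f) (lambda_z_idem g)).
move: (tens (idem f) (idem g)) => T; rewrite !scalerA.
congr (_ *: _); rewrite -mulrA mulrC -natrM mulnb; congr (_%:R * _).
by rewrite andbC -xpair_eqE [in RHS]eq_sym; case: h.
Qed.

Section Conjugation.

Variables (x : A) (k : bool).
Hypotheses (xz : lambda C z * x = x * lambda C z)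
           (xb : x * lambda C b = lambda C (z ^+ k * b)%g * x).

Lemma eigenproj_conj t : x * eigenproj C b t =
  2^-1 *: (1 + (-1) ^+ t *: lambda C (z ^+ k * b)%g) * x.
Proof.
by rewrite -scalerAr -scalerAl mulrDr mulrDl mulr1 mul1r -scalerAr -scalerAl xb.
Qed.

(** On the range of [eigenproj C z s] the element z is the scalar (-1)^s. *)
Lemma eigenproj_shear (s t : bool) :
  eigenproj C z s * (2^-1 *: (1 + (-1) ^+ t *: lambda C (z ^+ k * b)%g)) =
  eigenproj C z s * eigenproj C b (t (+) (k && s)).
Proof.
rewrite /(eigenproj C b _) -!scalerAr !mulrDr -!scalerAr; congr (_ *: (_ + _)).
case: k => /=; last by rewrite addbF mul1g.
rewrite expg1 lambdaM signr_addb mulrA -(@eigenproj_swap _ _ z) //.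
by rewrite lambda_eigenproj // -scalerAl scalerA.
Qed.

Lemma idem_conj f : x * idem f = idem (shear k f) * x.
Proof.
rewrite {1}/idem mulrA (@eigenproj_swap _ _ z) // -(mulrA _ x) eigenproj_conj.
by rewrite (mulrA _ _ x) eigenproj_shear.
Qed.

Lemma spec2_conj F :
  tens x x * spec2 F =
  spec2 (fun f g => F (shear k f) (shear k g)) * tens x x.
Proof.
rewrite mulr_sumr mulr_suml (reindex_inj (inv_inj (shearK k))) /=.
apply: eq_bigr => f _; rewrite mulr_sumr mulr_suml.
rewrite (reindex_inj (inv_inj (shearK k))) /=; apply: eq_bigr => g _.
by rewrite -scalerAr -scalerAl !tensM !idem_conj !shearK.
Qed.

End Conjugation.

End Fourier.

(** * The twisting element and the intrinsic group *)

Section KDIntrinsic.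

Variables (C : numClosedFieldType) (gT : finGroupType) (n : nat) (a b : gT).
Local Notation A := (galg C gT).
Local Notation z := (a ^+ n)%g.
Local Notation Omega := (KD_Omega C n a b).
Hypotheses (zz : (z * z = 1)%g) (bb : (b * b = 1)%g).
Hypothesis zC : forall g, commute z g.

Lemma KD_c_conj i j : (KD_c C i j)^* = KD_c C j i.
Proof.
rewrite /KD_c rmorphM fmorphV rmorph_nat; congr (_ / _).
by case: i j => [[|[|[|[|i]]]] ?] [[|[|[|[|j]]]] ?] //=;
  rewrite ?conjCK ?rmorph1 ?rmorph_nat.
Qed.

Lemma KD_h_invg i : ((KD_h n a b i)^-1 = KD_h n a b i)%g.
Proof.
have [bV zV] : (b^-1 = b /\ z^-1 = z)%g.
  by split; apply/eqP; rewrite eq_invg_mul ?bb ?zz.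
case: i => [[|[|[|[|i]]]] ?] //=; rewrite /KD_h /= ?invg1 ?zV ?bV //.
by rewrite invMg zV bV zC.
Qed.

Lemma KD_h_eqV g i : (g^-1 == KD_h n a b i)%g = (g == KD_h n a b i).
Proof. by rewrite -{1}KD_h_invg (inj_eq invg_inj). Qed.

Lemma OmegaE p q : Omega (p, q) =
  \sum_i \sum_j KD_c C i j * ((p == KD_h n a b i) && (q == KD_h n a b j))%:R.
Proof.
rewrite galg_sumE; apply: eq_bigr => i _; rewrite galg_sumE.
by apply: eq_bigr => j _; rewrite galgZE tens_lambda !ffunE xpair_eqE.
Qed.

(** The matrix (c_ij) is hermitian and the h_i are involutions. *)
Lemma star_Omega : galg_star Omega = flip Omega.
Proof.
apply/ffunP=> -[p q]; rewrite !ffunE /= OmegaE [RHS]OmegaE [RHS]exchange_big.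
rewrite rmorph_sum; apply: eq_bigr => i _; rewrite rmorph_sum.
apply: eq_bigr => j _; rewrite rmorphM rmorph_nat /= KD_c_conj andbC.
by rewrite !KD_h_eqV.
Qed.

(** The value at h_i of the character [f]. *)
Definition KD_char (i : 'I_4) (f : dual4) : C :=
  nth 0 [:: 1; (-1) ^+ f.1; (-1) ^+ f.2; (-1) ^+ f.2 * (-1) ^+ f.1] i.

Lemma lambda_KD_h i : lambda C (KD_h n a b i) = spec z b (KD_char i).
Proof.
apply: spec_eigen => // f.
have [ez eb] := (lambda_z_idem C b zz f, lambda_b_idem C bb (zC b) f).
case: i => [[|[|[|[|i]]]] ?] //=; rewrite /KD_h /KD_char /=.
- by rewrite lambda1 mul1r scale1r.
- by rewrite lambdaM -mulrA ez -scalerAr eb scalerA mulrC.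
Qed.

Lemma KD_c_fourier f g :
  \sum_i \sum_j KD_c C i j * (KD_char i f * KD_char j g) = pauli C f g.
Proof.
have i2 : 'i * 'i = -1 :> C by rewrite -expr2 sqrCi.
have i0 : 'i != 0 :> C by rewrite neq0Ci.
have nuE : (KD_nu C)^* = -1 - 'i *+ 2.
  by rewrite rmorphD rmorphN rmorph1 rmorphMn /= conjCi mulNrn.
rewrite !big_ord_recl !big_ord0 /KD_c /KD_char /= nuE /KD_nu.
rewrite /pauli /pauli_phase.
by case: f g => [[] []] [[] []] /=; rewrite ?expr0 ?expr1; field: i2;
  rewrite ?i0.
Qed.

Lemma Omega_spec2 : Omega = spec2 z b (@pauli C).
Proof.
apply: spec2_eigen => // f g; rewrite mulr_suml -KD_c_fourier scaler_suml.
apply: eq_bigr => i _; rewrite mulr_suml scaler_suml; apply: eq_bigr => j _.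
by rewrite !lambda_KD_h tens_spec -scalerAl spec2_idem // scalerA.
Qed.

Local Notation Om := (spec2 z b (@pauli C)).
Local Notation Om' := (spec2 z b (fun f g => @pauli C g f)).
Local Notation S := (spec2 z b (fun f g => (-1) ^+ sympl f g)).
Local Notation U := (spec z b (@usign C)).

Let OmV : Om * Om' = 1.
Proof.
rewrite spec2M // -(@spec2_1 C gT z b) //.
by apply: eq_spec2 => f g; rewrite pauli_sym.
Qed.

Let OmV' : Om' * Om = 1.
Proof.
rewrite spec2M // -(@spec2_1 C gT z b) //.
by apply: eq_spec2 => f g; rewrite pauli_sym.
Qed.

Let Om2 : Om * Om = S.
Proof. by rewrite spec2M //; apply: eq_spec2 => f g; rewrite pauli_square. Qed.

Let Om2' : Om' * Om' = S.
Proof.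
rewrite spec2M //; apply: eq_spec2 => f g; rewrite pauli_square.
by rewrite /sympl addbC andbC [X in _ (+) X]andbC.
Qed.

Lemma comul_KD x : comul (KD C n a b) x = Om * Delta_s x * Om'.
Proof. by rewrite /= star_Omega Omega_spec2 flip_spec2. Qed.

Lemma z_central x : lambda C z * x = x * lambda C z.
Proof. by rewrite lambda_central. Qed.

Lemma usign_square : U * U = 1.
Proof.
rewrite specM //; apply/esym/spec_eigen => // f.
by rewrite mul1r /usign; case: ifP => _; rewrite ?mulrNN mulr1 scale1r.
Qed.

Lemma usign_power_square k : U ^+ k * U ^+ k = 1.
Proof. by rewrite -exprMn_comm // usign_square expr1n. Qed.

Lemma Delta_s_usign : Delta_s U * S = tens U U.
Proof.
rewrite Delta_s_spec // spec2M // tens_spec //.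
by apply: eq_spec2 => f g; rewrite usign_coboundary.
Qed.

(** Conjugation by x (x) x fixes Omega when k = 0 and inverts it when k = 1, so
that the twisted equation becomes Delta_s(x) = S^k (x (x) x); the factor S^k is
then absorbed by U^k, of which S^k is the coboundary. *)
Lemma comul_untwist (x : A) (k : bool) :
    x * lambda C b = lambda C (z ^+ k * b)%g * x ->
  comul (KD C n a b) x = tens x x <->
  Delta_s (U ^+ k * x) = tens (U ^+ k * x) (U ^+ k * x).
Proof.
move=> xb; rewrite comul_KD Delta_sM -tensM.
have E : tens x x * Om =
    spec2 z b (fun f g => if k then pauli C g f else pauli C f g) * tens x x.
  rewrite (spec2_conj zz (z_central x) xb); congr (_ * _).
  apply: eq_spec2 => f g; case: k {xb}; first by rewrite pauli_shear.
  by rewrite /shear /= !addbF -!surjective_pairing.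
have -> : Om * Delta_s x * Om' = tens x x <-> Om * Delta_s x = tens x x * Om.
  split=> [<-|->]; first by rewrite -mulrA OmV' mulr1.
  by rewrite -mulrA OmV mulr1.
rewrite {}E; case: k {xb} => /=; last first.
  rewrite expr0 Delta_s1 tens11 !mul1r; split=> [/(congr1 ( *%R Om'))|->//].
  by rewrite !mulrA OmV' !mul1r.
rewrite expr1 -Delta_s_usign -mulrA.
split=> [e|/(congr1 ( *%R (Delta_s U)))].
  by rewrite -Om2' -[Om' * Om' * _]mulrA -e !mulrA -(mulrA _ Om') OmV' mulr1.
rewrite !mulrA -Delta_sM usign_square Delta_s1 !mul1r => ->.
by rewrite -Om2' !mulrA OmV mul1r.
Qed.

(** The symplectic form pairs z with b: on the (-1)^s-eigenspace of z in the
first factor, S acts as b^s on the second factor, and symmetrically. *)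
Lemma eigenproj_cut (s t : bool) :
  tens (eigenproj C z s) (eigenproj C z t) * S =
  tens (eigenproj C z s * lambda C (b ^+ t)%g)
       (eigenproj C z t * lambda C (b ^+ s)%g).
Proof.
have projE (r : bool) : eigenproj C z r = spec z b (fun f => (r == f.1)%:R).
  apply: spec_eigen => // f.
  exact: eigenproj_eigen (lambda_z_idem C b zz f).
have powE (r : bool) :
    lambda C (b ^+ r)%g = spec z b (fun f => (-1) ^+ (r && f.2)).
  apply: spec_eigen => // f; case: r => /=.
    by rewrite expg1 (lambda_b_idem C bb (zC b)).
  by rewrite expg0 lambda1 mul1r scale1r.
rewrite !projE !powE !specM // !tens_spec // spec2M //.
apply: eq_spec2 => f g /=; rewrite /sympl.
by case: s t f g => [] [] [[] []] [[] []] /=; rewrite ?expr0 ?expr1; ring.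
Qed.

Hypothesis z1 : z != 1%g.

(** Flipping the tensor factors shows that x (x) x commutes with S.  Let p0, p1
be the central projections (1 + z)/2 and (1 - z)/2.  Cut by p0 (x) p1, the
commutation says x p0 b = p0 b x, since the second factor p1 x is nonzero; cut
by p1 (x) p1 it equates two tensor squares, so x p1 b = p1 b x up to sign.  The
sign is the value of z^k on the range of p1. *)
Lemma intrinsic_conj x : in_intrinsic_group (KD C n a b) x ->
  exists k : bool, x * lambda C b = lambda C (z ^+ k * b)%g * x.
Proof.
case=> -[y [xy yx]]; rewrite comul_KD => e1.
have e2 : Om' * Delta_s x * Om = tens x x.
  by rewrite -flip_tens -e1 !flipM !flip_spec2 flip_Delta_s.
have xS : tens x x * S = S * tens x x.
  rewrite -Om2 !mulrA -{1}e1 -(mulrA _ Om' Om) OmV' mulr1.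
  by rewrite -e2 !mulrA -(mulrA Om Om Om') OmV mulr1.
have cut (s t : bool) : tens (x * eigenproj C z s * lambda C (b ^+ t)%g)
                             (x * eigenproj C z t * lambda C (b ^+ s)%g) =
    tens (eigenproj C z s * lambda C (b ^+ t)%g * x)
         (eigenproj C z t * lambda C (b ^+ s)%g * x).
  rewrite -[RHS]tensM -eigenproj_cut -[RHS]mulrA -xS [RHS]mulrA [in RHS]tensM.
  rewrite -!(eigenproj_swap _ (z_central x)) -[in RHS]tensM -[RHS]mulrA.
  by rewrite eigenproj_cut [RHS]tensM !mulrA.
pose p := eigenproj C z.
have sw s : x * p s = p s * x by rewrite eigenproj_swap ?z_central.
have p1x : p true * x != 0.
  apply/eqP => /(congr1 ( *%R^~ y)); rewrite -mulrA xy mulr1 mul0r.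
  (* The coefficient of (1 - z)/2 at the identity is 1/2, as z != 1. *)
  move/ffunP/(_ 1%g)/eqP; rewrite galgZE galgDE galgZE !ffunE eqxx.
  by rewrite (eq_sym 1%g) (negbTE z1) mulr0 addr0 mulr1 invr_eq0 pnatr_eq0.
have := cut false true; rewrite !expg0 lambda1 !mulr1 expg1 sw -/(p _).
rewrite sw => /(tens_cancel p1x) e01.
have e11 := cut true true; rewrite !expg1 -/(p _) in e11.
have xbE :
    x * lambda C b = x * p true * lambda C b + x * p false * lambda C b.
  by rewrite -mulrDl -mulrDr eigenproj_sum // mulr1.
case: (tens_square e11) => e; [exists false|exists true]; rewrite xbE e sw e01.
  by rewrite -mulrDl -mulrDl eigenproj_sum // mul1r mul1g.
rewrite expg1 lambdaM -!mulNr -!mulrDl; congr (_ * _ * _).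
rewrite -[RHS]mulr1 -(eigenproj_sum _ z) mulrDr !lambda_eigenproj //.
by rewrite expr1 scaleN1r expr0 scale1r.
Qed.

(** U^h commutes with b and with z, so it can be cancelled. *)
Lemma usign_conj (k : nat) h g :
  U ^+ h * lambda C g * lambda C b =
    lambda C (z ^+ k * b)%g * (U ^+ h * lambda C g)
  <-> (g * b = z ^+ k * b * g)%g.
Proof.
have bU : GRing.comm (lambda C b) U.
  rewrite (spec_eigen (lambda_b_idem C bb (zC b))) /GRing.comm.
  by rewrite !specM //; apply: eq_bigr => f _; rewrite mulrC.
have zbU : GRing.comm (lambda C (z ^+ k * b)%g) U.
  elim: k => [|k IH]; first by rewrite mul1g.
  rewrite expgS -mulgA lambdaM; apply/commr_sym/commrM; apply/commr_sym => //.
  exact: z_central.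
rewrite mulrA (commrX h zbU) -!mulrA -!lambdaM.
split=> [/(congr1 ( *%R (U ^+ h)))|-> //].
by rewrite !mulrA usign_power_square !mul1r => /lambda_inj.
Qed.

Lemma intrinsic_KD x : in_intrinsic_group (KD C n a b) x <->
  exists (k : bool) (g : gT),
    (g * b = z ^+ k * b * g)%g /\ x = U ^+ k * lambda C g.
Proof.
have Uk := usign_power_square.
split=> [xK|[k [g [gb ->]]]].
  have [k xb] := intrinsic_conj xK; case: xK => -[y [xy yx]].
  move/(comul_untwist xb) => /grouplike[|g xg].
    apply: contra_eq_neq yx => /(congr1 ( *%R (U ^+ k))).
    rewrite mulrA Uk mul1r mulr0 => ->.
    by rewrite mulr0 eq_sym oner_neq0.
  exists k, g; have xE : x = U ^+ k * lambda C g by rewrite -xg mulrA Uk mul1r.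
  by split=> //; move: xb; rewrite xE => /usign_conj.
split.
  exists (lambda C g^-1%g * U ^+ k); split.
    by rewrite mulrA -(mulrA _ (lambda _ g)) -lambdaM mulgV lambda1 mulr1 Uk.
  by rewrite mulrA -(mulrA _ _ (U ^+ k)) Uk mulr1 -lambdaM mulVg.
apply/(@comul_untwist _ k); first exact/usign_conj.
by rewrite mulrA Uk mul1r Delta_s_lambda.
Qed.

Lemma z_shift_inj (k l : bool) (h : gT) : (z ^+ k * h = z ^+ l * h)%g -> k = l.
Proof.
by move/mulIg; case: k l => [] [] //= /eqP; rewrite ?(eq_sym 1%g) (negbTE z1).
Qed.

Lemma usign_addb (k l : bool) : U ^+ (k (+) l) = U ^+ k * U ^+ l.
Proof.
by case: k l => [] []; rewrite /= ?expr0 ?expr1 ?mul1r ?mulr1 ?usign_square.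
Qed.

Lemma z_addb (k l : bool) : (z ^+ (k (+) l) = z ^+ k * z ^+ l)%g.
Proof. by case: k l => [] []; rewrite /= ?expg0 ?expg1 ?mul1g ?mulg1 ?zz. Qed.

Lemma shift_mul (k l : bool) g h :
    (g * b = z ^+ k * b * g)%g -> (h * b = z ^+ l * b * h)%g ->
  (g * h * b = z ^+ (k (+) l) * b * (g * h))%g.
Proof.
move=> gb hb; rewrite -mulgA hb !mulgA (commuteX l (commute_sym (zC g))).
by rewrite -(mulgA _ g) gb addbC z_addb !mulgA.
Qed.

(** Conjugation by such a [g] permutes the nontrivial characters, and [usign]
is constant on them. *)
Lemma usign_lambda (k : bool) g : (g * b = z ^+ k * b * g)%g ->
  lambda C g * U = U * lambda C g.
Proof.
move=> gb; have xb :
    lambda C g * lambda C b = lambda C (z ^+ k * b)%g * lambda C g.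
  by rewrite -!lambdaM gb.
rewrite mulr_sumr mulr_suml (reindex_inj (inv_inj (shearK k))).
apply: eq_bigr => f _; rewrite -scalerAr -scalerAl.
rewrite (idem_conj zz (z_central _) xb) shearK; congr (_ *: _).
by case: k {gb xb} f => -[[] []].
Qed.

(** The isomorphism is g |-> U^k(g) lambda(g), where k(g) is read off from
g b g^-1 = z^k(g) b.  It is multiplicative because k is a homomorphism to Z/2
and U commutes with the lambda(g) concerned; it is injective because its
value determines k(g), through its action on b. *)
Lemma intrinsic_isog (H : finGroupType) (G : {group gT}) :
  [set: H]%G \isog G ->
  (forall g, g \in G <-> exists k : bool, (g * b = z ^+ k * b * g)%g) ->
  intrinsic_group_isog (KD C n a b) H.
Proof.
case/isogP=> i /injmP inj_i im_i GP.
pose k (g : gT) : bool := (g * b != b * g)%g.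
have iG u : i u \in G by rewrite -im_i mem_morphim ?inE.
have kP g : g \in G -> (g * b = z ^+ k g * b * g)%g.
  case/GP=> l; rewrite /k; case: eqP => [-> _|gb]; first by rewrite mul1g.
  by case: l => //; rewrite mul1g.
have kE g (l : bool) : g \in G -> (g * b = z ^+ l * b * g)%g -> l = k g.
  by move=> /kP -> /esym; rewrite -!mulgA => /z_shift_inj.
exists (fun u => U ^+ k (i u) * lambda C (i u)); split=> [u v|u v|x].
- move=> e; have /(usign_conj (k (i u)) (k (i u)) (i u)) := kP _ (iG u).
  rewrite e => /usign_conj /(kE _ _ (iG v)) kuv.
  apply: inj_i; rewrite ?inE //; apply: (@lambda_inj C).
  move/(congr1 ( *%R (U ^+ k (i v)))): e; rewrite -{1}kuv !mulrA.
  by rewrite !usign_power_square // !mul1r.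
- rewrite morphM ?inE // lambdaM.
  have kM := shift_mul (kP _ (iG u)) (kP _ (iG v)).
  rewrite -(kE _ _ (groupM (iG u) (iG v)) kM).
  have cu : GRing.comm (lambda C (i u)) U := usign_lambda (kP _ (iG u)).
  rewrite usign_addb !mulrA -(mulrA (U ^+ _) (lambda _ _) (U ^+ _)).
  by rewrite (commrX _ cu) mulrA.
- rewrite intrinsic_KD //; split=> [[l [g [gb ->]]]|[u ->]]; last first.
    by exists (k (i u)), (i u); split=> //; apply: kP.
  have gG : g \in G by apply/GP; exists l.
  have := gG; rewrite -im_i => /morphimP[u _ _ gu].
  by exists u; rewrite -gu (kE _ _ gG gb).
Qed.

End KDIntrinsic.

(** * Dihedral groups and their dihedral subgroups *)

Section Dihedral.

Local Open Scope group_scope.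
Variables (gT : finGroupType) (m : nat) (a b : gT).
Hypotheses (m_gt0 : (0 < m)%N) (ab : dihedral_presentation m a b).

Lemma dihedral_inv i : b * a ^+ i = a ^- i * b.
Proof.
case: ab => _ _ _ ba _; elim: i => [|i IH]; first by rewrite invg1 mul1g mulg1.
by rewrite {1}expgSr mulgA IH -mulgA ba mulgA -invMg -expgS.
Qed.

Lemma dihedral_decomp :
  [/\ [set: gT] = <[a]> * <[b]>, #[a] = m & #[b] = 2].
Proof.
case: ab => gen am b2 ba card_gT.
have nab : <[b]> \subset 'N(<[a]>).
  rewrite cycle_subG; apply/normP; rewrite -cycleJ.
  have -> : a ^ b = a^-1; last by rewrite cycleV.
  apply: (mulgI b); rewrite conjgE mulKVg.
  by apply: (mulIg a); rewrite -mulgA ba mulKVg mulgKV.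
have defG : [set: gT] = <[a]> * <[b]>.
  by rewrite -gen -norm_joinEr //; rewrite joing_idl joing_idr.
have oa : (#[a] <= m)%N by rewrite dvdn_leq // order_dvdn am.
have ob : (#[b] <= 2)%N by rewrite dvdn_leq // order_dvdn b2.
(* The cardinality 2m forces both orders to be maximal. *)
have le_ab : (m * 2 <= #[a] * #[b])%N.
  have := mul_cardG <[a]> <[b]>; rewrite -defG cardsT card_gT -muln2 => ->.
  by rewrite leq_pmulr ?cardG_gt0.
have [oa_gt0 ob_gt0] := (order_gt0 a, order_gt0 b).
split=> //.
  apply/eqP; rewrite eqn_leq oa -(leq_pmul2r (isT : 0 < 2)%N).
  by rewrite (leq_trans le_ab) // leq_mul2l ob orbT.
apply/eqP; rewrite eqn_leq ob -(leq_pmul2l m_gt0).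
by rewrite (leq_trans le_ab) // leq_mul2r oa orbT.
Qed.

Lemma dihedral_TI : <[a]> :&: <[b]> = 1.
Proof.
have [defG oa ob] := dihedral_decomp; case: ab => _ _ _ _ card_gT.
apply: cardMg_TI; rewrite -defG cardsT card_gT -!orderE oa ob.
by rewrite muln2.
Qed.

Lemma dihedral_elt g : exists i j, g = a ^+ i * b ^+ j.
Proof.
have [defG _ _] := dihedral_decomp.
have : g \in [set: gT] by rewrite inE.
by rewrite defG => /mulsgP[_ _ /cycleP[i ->] /cycleP[j ->] ->]; exists i, j.
Qed.

(** a^i b^j conjugates b to a^(2i) b. *)
Lemma dihedral_shift k i j : let g := a ^+ i * b ^+ j in
  g * b = a ^+ k * b * g <-> a ^+ (i + i) = a ^+ k.
Proof.
move=> g; have -> : g * b = a ^+ i * b * b ^+ j.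
  by rewrite -!mulgA -expgS -expgSr.
have -> : a ^+ k * b * g = a ^+ k * a ^- i * b * b ^+ j.
  by rewrite /g !mulgA -(mulgA _ b) dihedral_inv !mulgA.
split=> [/mulIg/mulIg|e]; first by rewrite expgD => {1}->; rewrite mulgKV.
by rewrite -e expgD mulgK.
Qed.

Variable d : nat.
Hypothesis dm : (d %| m)%N.

Definition subdihedral : {group gT} := <[a ^+ d]> <*> <[b]>.

Lemma subdihedral_conj : (a ^+ d) ^ b = (a ^+ d)^-1.
Proof.
rewrite conjgE; apply: (mulgI b); rewrite mulKVg; apply: (mulIg (a ^+ d)).
by rewrite -mulgA dihedral_inv mulKVg mulgKV.
Qed.

Lemma subdihedralE : subdihedral = <[a ^+ d]> * <[b]> :> {set gT}.
Proof.
apply: norm_joinEr; rewrite cycle_subG; apply/normP.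
by rewrite -cycleJ subdihedral_conj cycleV.
Qed.

Lemma subdihedral_TI : <[a ^+ d]> :&: <[b]> = 1.
Proof.
have sa : <[a ^+ d]> \subset <[a]> by rewrite cycle_subG mem_cycle.
by apply/trivgP; rewrite -dihedral_TI setSI.
Qed.

Lemma order_subdihedral : #[a ^+ d] = (m %/ d)%N.
Proof. by have [_ oa _] := dihedral_decomp; rewrite orderXdiv oa. Qed.

Lemma card_subdihedral : #|subdihedral| = (m %/ d).*2.
Proof.
have [_ _ ob] := dihedral_decomp.
rewrite subdihedralE TI_cardMg ?subdihedral_TI //.
by rewrite -!orderE ob order_subdihedral muln2.
Qed.

Lemma mem_subdihedral i j :
  (a ^+ i * b ^+ j \in subdihedral) = (d %| i)%N.
Proof.
have [_ oa _] := dihedral_decomp.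
have sub_b : <[b]> \subset subdihedral by rewrite subdihedralE mulG_subr.
rewrite groupMr; last by rewrite (subsetP sub_b) ?mem_cycle.
apply/idP/idP=> [|/dvdnP[l ->]]; last first.
  rewrite subdihedralE (subsetP (mulG_subl _ _)) //.
  by rewrite mulnC expgM mem_cycle.
rewrite subdihedralE => /mulsgP[_ v /cycleP[l ->] vb e].
have : v \in <[a]> :&: <[b]>.
  rewrite inE vb andbT -(groupMl _ (mem_cycle a (d * l))) expgM -e.
  exact: mem_cycle.
rewrite dihedral_TI => /set1P v1; move/eqP: e; rewrite v1 mulg1 -expgM.
rewrite eq_expg_mod_order oa => /(_ =P _) e.
have := dvdn_mulr l (dvdnn d); rewrite (divn_eq (d * l) m).
rewrite dvdn_addr ?dvdn_mull // -e.
by rewrite -(dvdn_addr _ (dvdn_mull (i %/ m) dm)) -divn_eq.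
Qed.

Lemma subdihedral_abelem : (m %/ d = 2)%N -> 2.-abelem subdihedral.
Proof.
move=> md; have oc : #[a ^+ d] = 2 by rewrite order_subdihedral.
have ob : #[b] = 2 by have [_ _ ->] := dihedral_decomp.
have dN : <[a ^+ d]> \x <[b]> = subdihedral.
  apply: dprodEY => //=; last exact: subdihedral_TI.
  rewrite cycle_subG /= cent_cycle; apply/cent1P.
  apply/commute_sym/commgP/conjg_fixP; rewrite subdihedral_conj; apply/eqP.
  rewrite eq_invg_mul; apply/eqP; have := expg_order (a ^+ d).
  by rewrite oc expgS expg1.
by rewrite (dprod_abelem 2 dN) !prime_abelem // -orderE.
Qed.

Lemma subdihedral_isog :
  (1 < m %/ d)%N -> [set: 'D_(m %/ d).*2]%G \isog subdihedral.
Proof.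
move=> md; rewrite isog_sym isogEcard (Grp_dihedral md).
rewrite card_dihedral // card_subdihedral leqnn andbT.
apply/existsP; exists (a ^+ d, b); rewrite /= !xpair_eqE.
case: ab => _ _ b2 _ _.
by rewrite subdihedral_conj b2 -order_subdihedral expg_order !eqxx.
Qed.

End Dihedral.

Lemma Z2Z2_abelem_card :
  (2.-abelem [set: 'Z_2 * 'Z_2] && (#|[set: 'Z_2 * 'Z_2]| == 4))%g.
Proof.
have cZ : #|'Z_2| = 2 by rewrite card_ord.
have c2 : #|[set: 'Z_2]| = 2 by rewrite cardsT.
rewrite cardsT card_prod cZ andbT.
have -> : [set: 'Z_2 * 'Z_2] = setX [set: 'Z_2] [set: 'Z_2].
  by apply/setP=> x; rewrite !inE.
rewrite (dprod_abelem 2 (setX_dprod [set: 'Z_2]%G [set: 'Z_2]%G)).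
by rewrite !prime_abelem // cardsX cards1 c2.
Qed.

(** * The congruence that selects the intrinsic group *)

(** The exponent condition a^(2i) in {1, a^n}, where a has order 2n. *)
Lemma dvdn_double_mod (n i : nat) :
  (n %| i.*2)%N <-> exists k : bool, (i.*2 = n * k %[mod n.*2])%N.
Proof.
split=> [/dvdnP[l il]|[k e]].
  exists (odd l); rewrite il -{1}(odd_double_half l) mulnDl -doubleMl.
  by rewrite doubleMr addnC modnMDl mulnC.
have n2 : (n %| n.*2)%N by rewrite -muln2 dvdn_mulr.
by rewrite /dvdn -(modn_dvdm _ n2) e modn_dvdm // modnMr.
Qed.

Lemma even_dvd_double (n i : nat) : ~~ odd n -> (n %| i.*2)%N = (n./2 %| i)%N.
Proof. by move=> /even_halfK {1}<-; rewrite -!muln2 dvdn_pmul2r. Qed.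

Lemma odd_dvd_double (n i : nat) : odd n -> (n %| i.*2)%N = (n %| i)%N.
Proof. by move=> n_odd; rewrite -mul2n Gauss_dvdr // coprimen2. Qed.

Theorem proposition5p4p3 (R : realType) (n : nat) (n_ge1 : (1 <= n)%N)
    (gT : finGroupType) (a b : gT)
    (ab : dihedral_presentation n.*2 a b) :
  (odd n -> intrinsic_group_isog (KD R[i] n a b) ('Z_2 * 'Z_2)%type) /\
  (~~ odd n -> intrinsic_group_isog (KD R[i] n a b) ('D_8)%type).
Proof.
have n2_gt0 : (0 < n.*2)%N by rewrite double_gt0.
have [_ oa ob] := dihedral_decomp n2_gt0 ab.
have zz : (a ^+ n * a ^+ n = 1)%g by rewrite -expgD addnn -oa expg_order.
have bb : (b * b = 1)%g by rewrite -[RHS](expg_order b) ob expgS expg1.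
have zV : (a ^- n = a ^+ n)%g by apply/eqP; rewrite eq_invg_mul zz.
have zC g : commute (a ^+ n)%g g.
  have [i [j ->]] := dihedral_elt n2_gt0 ab g.
  apply: commuteM; first by apply: commuteX2.
  by apply/commuteX/commute_sym; rewrite /commute (dihedral_inv ab) zV.
have z1 : (a ^+ n != 1)%g.
  rewrite -order_dvdn oa; apply/negP=> /(dvdn_leq n_ge1).
  by rewrite leqNgt -addnn -{1}(addn0 n) ltn_add2l n_ge1.
have GP d : (d %| n.*2)%N -> (forall i, (n %| i.*2)%N = (d %| i)%N) ->
    forall g, g \in subdihedral a b d <->
      exists k : bool, (g * b = (a ^+ n) ^+ k * b * g)%g.
  move=> dn di g; have [i [j ->]] := dihedral_elt n2_gt0 ab g.
  rewrite (mem_subdihedral n2_gt0 ab dn) -di dvdn_double_mod.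
  have shift (k : bool) : (i.*2 = n * k %[mod n.*2])%N <->
      (a ^+ i * b ^+ j * b = (a ^+ n) ^+ k * b * (a ^+ i * b ^+ j))%g.
    rewrite -expgM (dihedral_shift ab) addnn -oa.
    split=> /eqP e; apply/eqP; first by rewrite eq_expg_mod_order.
    by rewrite -eq_expg_mod_order.
  by split=> -[k /shift]; exists k.
split=> n_par.
  have dn : (n %| n.*2)%N by rewrite -muln2 dvdn_mulr.
  have nn : (n.*2 %/ n = 2)%N by rewrite -muln2 mulKn.
  apply: (@intrinsic_isog _ _ n a b zz bb zC z1 _ (subdihedral a b n)).
    have /andP[abZ /eqP cZ] := Z2Z2_abelem_card.
    rewrite (isog_abelem_card _ abZ) (subdihedral_abelem n2_gt0 ab dn nn) cZ.
    by rewrite (card_subdihedral n2_gt0 ab dn) nn.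
  by apply: GP => // i; apply: odd_dvd_double.
have n2E : (n.*2 = 4 * n./2)%N.
  by rewrite -{1}(even_halfK n_par) -!muln2 -mulnA mulnC.
have n2_half : (0 < n./2)%N by move: n2_gt0; rewrite n2E; case: n./2.
have nn : (n.*2 %/ n./2 = 4)%N by rewrite n2E mulnK.
have dn : (n./2 %| n.*2)%N by rewrite n2E dvdn_mull.
apply: (@intrinsic_isog _ _ n a b zz bb zC z1 _ (subdihedral a b n./2)).
  by have := subdihedral_isog n2_gt0 ab dn; rewrite nn; apply.
by apply: GP => // i; apply: even_dvd_double.
Qed.
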